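(* Let $f:X\to Y$ be an onto monotone mapping between continua, let $A\in 2^Y$ and let $n\in\mathbb N$. The following statements hold: (1) if $A\in CC_n(Y)$, then $f^{-1}(A)\in CC_n(X)$; (2) if $A\in NWC_n(Y)$, then $f^{-1}(A)\in NWC_n(X)$; (3) if $A\in NC_n(Y)$, then $f^{-1}(A)\in NC_n(X)$.
   Context: All spaces are metric; a mapping is a continuous function; a mapping $f:X\to Y$ is monotone if $f^{-1}(y)$ is connected for each $y\in Y$; a continuum is a compact connected space with more than one point; $\mathbb N=\{1,2,\dots\}$. For a non-empty space $Z$ and $n\in\mathbb N$: $2^Z$ is the set of non-empty compact subsets of $Z$; $F_n(Z)$ is the set of elements of $2^Z$ with at most $n$ points. A non-empty space $Z$ is (interiors taken in $Z$): - $n$-$Q1$ if there exists $B\in F_n(Z)$ such that for each $x\in Z$ there exists a continuum $D\subset Z$ with $x\in \mathrm{int}(D)$ and $B\cap D\neq\emptyset$; - $n$-$Q2$ if there exists $B\in F_n(Z)$ such that for each $x\in Z$ there exists a continuum $D\subset Z$ with $x\in D$ and $B\cap D\neq\emptyset$. For a non-degenerate compact metric space $Z$: $CC_n(Z)=\{A\in 2^Z: A=Z$ or $Z-A$ is $n$-$Q1\}$; $NWC_n(Z)=\{A\in 2^Z: A=Z$ or $Z-A$ is $n$-$Q2\}$; $NC_n(Z)=\{A\in 2^Z: Z-A$ has at most $n$ components$\}$. *)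

(* Defs.v *)
From mathcomp Require Export all_boot all_order all_algebra.
From mathcomp Require Export all_classical all_reals all_analysis.

Set Implicit Arguments.
Unset Strict Implicit.
Unset Printing Implicit Defensive.

Local Open Scope classical_set_scope.
Local Open Scope card_scope.

(* The spaces Z below are the subspaces of an ambient space T, so a space Z is
   given as a set in T and [set: T] is the whole space. Compactness and
   connectedness of D `<=` Z do not depend on whether D is viewed in Z or in T;
   the interior does, and is taken in the topology of subspace Z. *)
Section Spaces.
Context {T : topologicalType}.

Definition continuum (D : set T) : Prop :=
  [/\ compact D, connected D & exists x y, [/\ D x, D y & x <> y]].

(* 2^Z *)
Definition hyperspace (Z : set T) : set (set T) :=
  [set B | [/\ B `<=` Z, B !=set0 & compact B]].

(* F_n(Z) *)
Definition symmetric_product (n : nat) (Z : set T) : set (set T) :=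
  [set B | hyperspace Z B /\ B #<= `I_n].

Definition Q1 (n : nat) (Z : set T) : Prop :=
  Z !=set0 /\
  exists2 B, symmetric_product n Z B &
    forall x, Z x -> exists D : set T,
      [/\ D `<=` Z, continuum D, @interior (subspace Z) D x & B `&` D !=set0].

Definition Q2 (n : nat) (Z : set T) : Prop :=
  Z !=set0 /\
  exists2 B, symmetric_product n Z B &
    forall x, Z x -> exists D : set T,
      [/\ D `<=` Z, continuum D, D x & B `&` D !=set0].

Definition components (Z : set T) : set (set T) :=
  [set connected_component Z x | x in Z].

End Spaces.

Definition CC (T : topologicalType) (n : nat) : set (set T) :=
  [set A | hyperspace [set: T] A /\ (A = [set: T] \/ Q1 n (~` A))].

Definition NWC (T : topologicalType) (n : nat) : set (set T) :=
  [set A | hyperspace [set: T] A /\ (A = [set: T] \/ Q2 n (~` A))].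

Definition NC (T : topologicalType) (n : nat) : set (set T) :=
  [set A | hyperspace [set: T] A /\ components (~` A) #<= `I_n].

Arguments CC : clear implicits.
Arguments NWC : clear implicits.
Arguments NC : clear implicits.

Definition monotone_mapping (X Y : topologicalType) (f : X -> Y) : Prop :=
  continuous f /\ forall y : Y, connected (f @^-1` [set y]).

(* Main.v *)
Require Import Defs.

(** Under a continuous map [f] from a compact space onto a Hausdorff space,
    closed sets have closed images.  If moreover the fibres of [f] are
    connected, then the preimage of every connected set is connected
    ([connected_preimage]): a clopen piece of such a preimage is a union of
    fibres, and a closed map sends it to a clopen piece of the connected set
    below.

    All three statements pull structure back from the complement of [A] to the
    complement of [f @^-1` A], which is the preimage of the former.
    For [CC] and [NWC], the preimage of a continuum is a continuum
    ([continuum_preimage]), and if [B] is the finite set that the continua must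
    meet, then one point chosen in the fibre of each point of [B] gives a set
    with no more points than [B] which meets the preimage of every set met by
    [B] ([symmetric_product_lift]).  For [CC], continuity also pulls back
    relative interiors ([interior_subspace_preimage]).  For [NC], the preimage
    of the component of [f x] is the component of [x]
    ([connected_component_preimage]), so every component upstairs is the
    preimage of a component downstairs. *)

Local Open Scope classical_set_scope.
Local Open Scope card_scope.

Lemma closed_image (X Y : topologicalType) (f : X -> Y) (F : set X) :
  compact [set: X] -> hausdorff_space Y -> continuous f ->
  closed F -> closed (f @` F).
Proof.
move=> Xc hausY fcont Fcl; apply: compact_closed => //.
apply: continuous_compact; first exact: continuous_subspaceT.
exact: subclosed_compact Fcl Xc _.
Qed.

Lemma surj_fiber (X Y : Type) (f : X -> Y) (y : Y) :
  set_surj [set: X] [set: Y] f -> exists x, f x = y.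
Proof. by move=> /(_ y I)[x _ <-]; exists x. Qed.

(** The connectedness of [C] is applied to [f @` B], for a relatively clopen
    part [B = f @^-1` C `&` U = f @^-1` C `&` F] of the preimage.  Since each
    fibre over [C] lies entirely inside or outside [B], this image is both
    [C `&` f @` F] and [C `\` f @` (~` U)], hence relatively clopen because [f]
    is closed. *)
Lemma connected_preimage (X Y : topologicalType) (f : X -> Y) (C : set Y) :
  set_surj [set: X] [set: Y] f ->
  (forall F, closed F -> closed (f @` F)) ->
  (forall y, connected (f @^-1` [set y])) ->
  connected C -> connected (f @^-1` C).
Proof.
move=> fsurj fclosed fib Ccon B [b0 Bb0] [U Uopen BU] [F Fcl BF].
have saturated x b : B b -> f x = f b -> B x.
  move=> Bb fxb.
  have Cb : C (f b) by move: Bb; rewrite BU => -[].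
  have fibC z : f z = f b -> C (f z) by move=> ->.
  have fibB : f @^-1` [set f b] `&` B = f @^-1` [set f b].
    apply: fib; first by exists b.
    - exists U => //; rewrite BU; apply/seteqP; split => z /=.
        by move=> [zb [_ Uz]].
      by move=> [zb Uz]; split=> //; split=> //; exact: fibC.
    - exists F => //; rewrite BF; apply/seteqP; split => z /=.
        by move=> [zb [_ Fz]].
      by move=> [zb Fz]; split=> //; split=> //; exact: fibC.
  by have [] : (f @^-1` [set f b] `&` B) x by rewrite fibB.
have imB : f @` B = C.
  apply: Ccon; first by exists (f b0), b0.
  - exists (~` (f @` (~` U))).
      by apply: closed_openC; apply: fclosed; exact: open_closedC.
    apply/seteqP; split => y /=.
      move=> [b Bb <-]; split; first by move: Bb; rewrite BU => -[].
      move=> [z nUz fzb]; apply: nUz.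
      by have := saturated z b Bb fzb; rewrite BU => -[].
    move=> [Cy nUy]; have [x fxy] := surj_fiber _ _ f y fsurj.
    exists x => //; rewrite BU; split; first by rewrite /= fxy.
    by apply: contrapT => nUx; apply: nUy; exists x.
  - exists (f @` F); first exact: fclosed.
    apply/seteqP; split => y /=.
      by move=> [b]; rewrite BF => -[Cb Fb] <-; split => //; exists b.
    by move=> [Cy [x Fx fxy]]; exists x => //; rewrite BF; split; rewrite //= fxy.
apply/seteqP; split => x; first by rewrite BU => -[].
by rewrite -{1}imB => -[b Bb fbx]; exact: saturated Bb (esym fbx).
Qed.

Lemma compact_preimage (X Y : topologicalType) (f : X -> Y) (D : set Y) :
  compact [set: X] -> hausdorff_space Y -> continuous f ->
  compact D -> compact (f @^-1` D).
Proof.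
move=> Xc hausY fcont Dc; apply: (subclosed_compact _ Xc) => //.
apply: preimage_closed; first by move=> x _; exact: fcont.
exact: compact_closed.
Qed.

Lemma continuum_preimage (X Y : topologicalType) (f : X -> Y) (D : set Y) :
  compact [set: X] -> hausdorff_space Y ->
  set_surj [set: X] [set: Y] f -> monotone_mapping f ->
  continuum D -> continuum (f @^-1` D).
Proof.
move=> Xc hausY fsurj [fcont fib] [Dc Dcon [u [v [Du Dv uv]]]]; split.
- exact: compact_preimage.
- by apply: connected_preimage => // F; exact: closed_image.
- have [x fx] := surj_fiber _ _ f u fsurj; have [y fy] := surj_fiber _ _ f v fsurj.
  exists x, y; split; rewrite /= ?fx ?fy // => xy.
  by apply: uv; rewrite -fx -fy xy.
Qed.

Lemma hyperspace_preimage (X Y : topologicalType) (f : X -> Y) (A : set Y) :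
  compact [set: X] -> hausdorff_space Y -> continuous f ->
  set_surj [set: X] [set: Y] f ->
  hyperspace [set: Y] A -> hyperspace [set: X] (f @^-1` A).
Proof.
move=> Xc hausY fcont fsurj [_ [y Ay] Ac]; split => //.
  by have [x fxy] := surj_fiber _ _ f y fsurj; exists x; rewrite /= fxy.
exact: compact_preimage.
Qed.

(** At a point of [Z], membership in the relative interior of [D] says that
    [Z y -> D y] holds for all [y] near the point of the ambient space, and
    continuity pulls this implication back. *)
Lemma interior_subspace_preimage (X Y : topologicalType) (f : X -> Y)
    (Z D : set Y) (x : X) :
  continuous f -> Z (f x) -> @interior (subspace Z) D (f x) ->
  @interior (subspace (f @^-1` Z)) (f @^-1` D) x.
Proof.
move=> fcont Zfx.
change (nbhs_subspace (A := Z) (f x) D ->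
  nbhs_subspace (A := f @^-1` Z) x (f @^-1` D)).
rewrite -!nbhs_subspace_in //.
by move=> /(fcont x).
Qed.

Lemma symmetric_product_lift (X Y : topologicalType) (f : X -> Y) (n : nat)
    (Z B : set Y) :
  set_surj [set: X] [set: Y] f -> symmetric_product n Z B ->
  exists2 B', symmetric_product n (f @^-1` Z) B' &
    forall D, B `&` D !=set0 -> B' `&` f @^-1` D !=set0.
Proof.
move=> fsurj [[BZ [b Bb] _] Bn].
have [g gK] := choice (fun y => surj_fiber _ _ f y fsurj).
have gBn : g @` B #<= `I_n := card_le_trans (card_image_le g B) Bn.
exists (g @` B).
  split=> //; split.
  - by move=> _ [y By <-]; rewrite /= gK; exact: BZ.
  - by exists (g b), b.
  - by apply: finite_compact; apply: card_le_finite gBn _; exact: finite_II.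
by move=> D [y [By Dy]]; exists (g y); split; [exists y | rewrite /= gK].
Qed.

Lemma Q1_preimage (X Y : topologicalType) (f : X -> Y) (n : nat) (Z : set Y) :
  compact [set: X] -> hausdorff_space Y ->
  set_surj [set: X] [set: Y] f -> monotone_mapping f ->
  Q1 n Z -> Q1 n (f @^-1` Z).
Proof.
move=> Xc hausY fsurj fmon [[z Zz] [B Bsym BP]]; split.
  by have [x fxz] := surj_fiber _ _ f z fsurj; exists x; rewrite /= fxz.
have [B' B'sym B'B] := symmetric_product_lift _ _ f n Z B fsurj Bsym.
exists B' => // x Zfx; have [D [DZ Dcont Dint BD]] := BP _ Zfx.
exists (f @^-1` D); split.
- by move=> t; exact: DZ.
- exact: continuum_preimage.
- by apply: interior_subspace_preimage => //; case: fmon.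
- exact: B'B.
Qed.

Lemma Q2_preimage (X Y : topologicalType) (f : X -> Y) (n : nat) (Z : set Y) :
  compact [set: X] -> hausdorff_space Y ->
  set_surj [set: X] [set: Y] f -> monotone_mapping f ->
  Q2 n Z -> Q2 n (f @^-1` Z).
Proof.
move=> Xc hausY fsurj fmon [[z Zz] [B Bsym BP]]; split.
  by have [x fxz] := surj_fiber _ _ f z fsurj; exists x; rewrite /= fxz.
have [B' B'sym B'B] := symmetric_product_lift _ _ f n Z B fsurj Bsym.
exists B' => // x Zfx; have [D [DZ Dcont Dfx BD]] := BP _ Zfx.
exists (f @^-1` D); split => //.
- by move=> t; exact: DZ.
- exact: continuum_preimage.
- exact: B'B.
Qed.

(** Maximality of components, used twice: the preimage of the component of
    [f x] is connected, hence lies in the component of [x], whose image is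
    connected, hence lies in the component of [f x]. *)
Lemma connected_component_preimage (X Y : topologicalType) (f : X -> Y)
    (Z : set Y) (x : X) :
  compact [set: X] -> hausdorff_space Y ->
  set_surj [set: X] [set: Y] f -> monotone_mapping f -> Z (f x) ->
  connected_component (f @^-1` Z) x = f @^-1` connected_component Z (f x).
Proof.
move=> Xc hausY fsurj [fcont fib] Zfx; apply/seteqP; split => [t xt|].
  have im : f @` connected_component (f @^-1` Z) x
      `<=` connected_component Z (f x).
    apply: connected_component_max.
    - by exists x => //; apply: connected_component_refl; rewrite ?inE.
    - by move=> _ [s /connected_component_sub Zs <-].
    - apply: connected_continuous_connected.
        exact: component_connected.
      exact: continuous_subspaceT.
  by apply: im; exists t.
apply: connected_component_max.
- by apply: connected_component_refl; rewrite ?inE.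
- by move=> t /connected_component_sub.
- apply: connected_preimage => //; first by move=> F; exact: closed_image.
  exact: component_connected.
Qed.

Lemma components_preimage (X Y : topologicalType) (f : X -> Y) (Z : set Y) :
  compact [set: X] -> hausdorff_space Y ->
  set_surj [set: X] [set: Y] f -> monotone_mapping f ->
  components (f @^-1` Z) #<= components Z.
Proof.
move=> Xc hausY fsurj fmon.
apply: card_le_trans (card_image_le (fun C => f @^-1` C) (components Z)).
apply: subset_card_le => _ [x Zfx <-].
exists (connected_component Z (f x)); first by exists (f x).
by rewrite connected_component_preimage.
Qed.

Theorem proposition4p5 (R : realType) (X Y : metricType R) (f : X -> Y)
    (hX : continuum [set: X]) (hY : continuum [set: Y])
    (hf_onto : set_surj [set: X] [set: Y] f) (hf : monotone_mapping f)
    (A : set Y) (hA : hyperspace [set: Y] A) (n : nat) (hn : (0 < n)%N) :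
  [/\ CC Y n A -> CC X n (f @^-1` A),
      NWC Y n A -> NWC X n (f @^-1` A)
    & NC Y n A -> NC X n (f @^-1` A)].
Proof.
have [Xc _ _] := hX; have [fcont _] := hf.
have hausY : hausdorff_space Y := @metric_hausdorff R Y.
have hfA : hyperspace [set: X] (f @^-1` A) by exact: hyperspace_preimage.
split=> -[_ AP]; split => //.
- by case: AP => [->|AQ]; [left | right; rewrite preimage_setC; exact: Q1_preimage].
- by case: AP => [->|AQ]; [left | right; rewrite preimage_setC; exact: Q2_preimage].
- by rewrite preimage_setC; apply: card_le_trans AP; exact: components_preimage.
Qed.
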